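(* Let $a,b\in\mathbb{R}$ with $b>a>0$ and let $f,g:[a,b]\to\mathbb{R}$ be two absolutely continuous functions. If $f',g'\in L_2[a,b]$, then $$\left|\widehat{\mathcal{P}}(f,g)\right|\le\frac{2}{9\pi^2}\,\frac{b^2}{a^6}\left(b^3-a^3\right)^2(b-a)\cdot\left\|\ell f'-f\right\|_2\left\|\ell g'-g\right\|_2,$$ where $\ell(t)=t$ for $t\in[a,b]$.
   Context: For $b>a>0$ and real functions $f,g$ on $[a,b]$, the (Pompeiu–Chebyshev) functional is $$\widehat{\mathcal{P}}(f,g)=\frac{b^3-a^3}{3}\int_a^b f(x)g(x)\,dx-\left(\int_a^b x f(x)\,dx\right)\left(\int_a^b x g(x)\,dx\right).$$ $\|\cdot\|_2$ is the $L_2$ norm on $[a,b]$. *)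

(* Defs.v *)
From HB Require Import structures.
From mathcomp Require Import all_boot all_order all_algebra.
From mathcomp Require Import all_classical all_reals all_analysis.
Set Implicit Arguments.
Unset Strict Implicit.
Unset Printing Implicit Defensive.
Import Order.TTheory GRing.Theory Num.Theory.
Import numFieldNormedType.Exports.
Local Open Scope classical_set_scope.
Local Open Scope ring_scope.

(* A function on [a, b] is represented by a total function f : R -> R. Values of
   f outside [a, b] can matter only through derive1 f at a and b, i.e. on a
   Lebesgue-null set. The default value of derive1 f where f is not
   differentiable is irrelevant too: an absolutely continuous f is
   differentiable almost everywhere on [a, b]. *)

Definition abs_continuous (R : realType) (a b : R) (f : R -> R) : Prop :=
  forall e : R, 0 < e -> exists2 d : R, 0 < d &
    forall (n : nat) (x y : 'I_n -> R),
      (forall i, a <= x i /\ x i < y i /\ y i <= b) ->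
      trivIset [set: 'I_n] (fun i => `]x i, y i[%classic) ->
      \sum_(i < n) (y i - x i) < d ->
      \sum_(i < n) `|f (y i) - f (x i)| < e.

(* L_2[a, b] is identified with the functions of L_2(R) that vanish outside
   [a, b]: h \_ D is h on D and 0 elsewhere, so nothing is required of h
   outside [a, b]. *)
Definition in_L2 (R : realType) (a b : R) (h : R -> R) : Prop :=
  h \_ `[a, b]%classic \in Lfun (@lebesgue_measure R) 2%:E.

(* Extended-real valued: the norm is +oo on measurable functions that are not
   in L_2[a, b]. *)
Definition L2norm (R : realType) (a b : R) (h : R -> R) : \bar R :=
  'N[@lebesgue_measure R]_2%:E [EFin \o (h \_ `[a, b]%classic)]%E.

Definition pompeiu_chebyshev (R : realType) (a b : R) (f g : R -> R) : R :=
  (b ^+ 3 - a ^+ 3) / 3 *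
      (\int[@lebesgue_measure R]_(x in `[a, b]) (f x * g x)) -
  (\int[@lebesgue_measure R]_(x in `[a, b]) (x * f x)) *
  (\int[@lebesgue_measure R]_(x in `[a, b]) (x * g x)).

(* Main.v *)
Require Import Defs.
From HB Require Import structures.
From mathcomp Require Import all_boot all_order all_algebra.
From mathcomp Require Import all_classical all_reals all_analysis.
From mathcomp Require Import measurable_realfun ring lra.
Import Order.TTheory GRing.Theory Num.Theory.
Import numFieldNormedType.Exports.
Local Open Scope classical_set_scope.
Local Open Scope ring_scope.

Set Implicit Arguments.
Unset Strict Implicit.
Unset Printing Implicit Defensive.

(** Put W = (b^3 - a^3) / 3, the integral of x^2 over [a, b]. The functional
    P(f, g) is W times the L_2 scalar product of f and g, minus the product of
    their scalar products with x; so it does not change when multiples of x are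
    subtracted from f and g ([pompeiu_chebyshev_shift]), and Cauchy-Schwarz
    gives |P(f, g)| <= W |f - c x|_2 |g - d x|_2 for all constants c and d
    ([pompeiu_chebyshev_le]).

    Let F = f / x, let m be the midpoint of [a, b] and take c = F(m). Then
    f - c x = x (F - F(m)) and F' = (x f' - f) / x^2, so that f - c x is
    controlled by x f' - f through a Poincare inequality for F
    ([pompeiu_single_bound]). From (F y - F x)^2 <= (y - x) int_x^y F'^2 on each
    half of [a, b] one gets int (F - F(m))^2 <= (b - a)^2 / 8 int F'^2
    ([poincare_midpoint]). The constant 1/8 is larger than the sharp 1 / pi^2
    of Wirtinger's inequality, but the factor 2 / pi^2 of the theorem leaves
    room for it because pi <= 4; the remaining estimate is a^2 (b - a) <= W
    ([pompeiu_constant_le]).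

    The analytic input is the fundamental theorem of calculus for an absolutely
    continuous F: it is differentiable almost everywhere and it is the integral
    of its derivative ([abs_continuous_integral_deriv]). With v the total
    variation of F, both v and v - F are nondecreasing and absolutely continuous
    ([ac_line_majorant]). The Stieltjes measure of a nondecreasing absolutely
    continuous function vanishes on Lebesgue-null sets ([ac_stieltjes_null]),
    hence has a density by the Radon-Nikodym theorem
    ([nondecreasing_ac_density]), and Lebesgue's differentiation theorem
    identifies the density of F with F' almost everywhere
    ([abs_continuous_deriv]). *)

(** * Absolute continuity along lists of segments *)

(** A family of segments is a list of pairs of endpoints: a segment is then
    replaced by the pieces of a partition through concatenation of lists.
    Degenerate segments are allowed, so that a family remains a family after
    its endpoints are clamped to [a, b]. *)
Definition seg_le (R : realType) (p : R * R) : bool := p.1 <= p.2.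

Definition seg_sep (R : realType) (p q : R * R) : bool :=
  (p.2 <= q.1) || (q.2 <= p.1).

Definition seg_length (R : realType) (L : seq (R * R)) : R :=
  \sum_(p <- L) (p.2 - p.1).

Definition seg_var (R : realType) (f : R -> R) (L : seq (R * R)) : R :=
  \sum_(p <- L) `|f p.2 - f p.1|.

Lemma seg_length_cat (R : realType) (L1 L2 : seq (R * R)) :
  seg_length (L1 ++ L2) = seg_length L1 + seg_length L2.
Proof. exact: big_cat. Qed.

Lemma seg_var_cat (R : realType) (f : R -> R) (L1 L2 : seq (R * R)) :
  seg_var f (L1 ++ L2) = seg_var f L1 + seg_var f L2.
Proof. exact: big_cat. Qed.

Definition ac_mod (R : realType) (f : R -> R) (e d : R) :=
  forall L : seq (R * R), all (@seg_le R) L -> pairwise (@seg_sep R) L ->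
    seg_length L < d -> seg_var f L < e.

(** Absolute continuity on the whole line, which spares the bookkeeping of a
    domain; it applies to f on [a, b] through [f \o clamp a b]. *)
Definition ac_line (R : realType) (f : R -> R) :=
  forall e : R, 0 < e -> exists2 d : R, 0 < d & ac_mod f e d.

Definition clamp (R : realType) (a b x : R) : R := Num.max a (Num.min b x).

Section Clamp.
Context {R : realType} (a b : R) (ab : a <= b).

Lemma clamp_ge x : a <= clamp a b x.
Proof. by rewrite /clamp le_max lexx. Qed.

Lemma clamp_le x : clamp a b x <= b.
Proof. by rewrite /clamp ge_max ab ge_min lexx. Qed.

Lemma clamp_id x : a <= x <= b -> clamp a b x = x.
Proof.
move=> /andP[ax xb]; rewrite /clamp.
by have /min_idPr -> := xb; have /max_idPr -> := ax.
Qed.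

Lemma clampK x : clamp a b (clamp a b x) = clamp a b x.
Proof. by rewrite clamp_id// clamp_ge clamp_le. Qed.

Lemma clamp_homo x y : x <= y -> clamp a b x <= clamp a b y.
Proof.
move=> xy; rewrite /clamp; apply: le_max2 => //; apply: le_min2 => //.
Qed.

Lemma clamp_lip x y : x <= y -> clamp a b y - clamp a b x <= y - x.
Proof.
move=> xy; rewrite /clamp; case: (leP b y) => ?; case: (leP b x) => ?;
  case: (leP a b) => ?; case: (leP a y) => ?; case: (leP a x) => ?; lra.
Qed.

End Clamp.

Definition clamp_seg (R : realType) (a b : R) (p : R * R) : R * R :=
  (clamp a b p.1, clamp a b p.2).

Section ClampSeg.
Context {R : realType} (a b : R) (ab : a <= b).

Lemma clamp_seg_le L : all (@seg_le R) L ->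
  all (@seg_le R) (map (clamp_seg a b) L).
Proof.
rewrite all_map => /allP LL; apply/allP => p /LL; exact: clamp_homo.
Qed.

Lemma clamp_seg_sep L : pairwise (@seg_sep R) L ->
  pairwise (@seg_sep R) (map (clamp_seg a b) L).
Proof.
rewrite pairwise_map; apply: sub_pairwise => p q.
by rewrite /relpre/= /seg_sep => /orP[] /(clamp_homo a b) ->; rewrite ?orbT.
Qed.

Lemma clamp_seg_length L : all (@seg_le R) L ->
  seg_length (map (clamp_seg a b) L) <= seg_length L.
Proof.
move=> LL; rewrite /seg_length big_map big_seq [leRHS]big_seq.
by apply: ler_sum => p /(allP LL); exact: clamp_lip.
Qed.

End ClampSeg.

(** Clamping shortens segments and keeps them apart; a segment that it makes
    degenerate contributes nothing to the variation and can be dropped, which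
    restores the strict inequalities of [abs_continuous]. *)
Lemma ac_line_clamp (R : realType) (a b : R) (f : R -> R) : a <= b ->
  abs_continuous a b f -> ac_line (f \o clamp a b).
Proof.
move=> ab acf e /acf[d d0 fd]; exists d => // L LL LS Ld.
pose C := [seq clamp_seg a b p | p <- L].
pose L' := [seq p <- C | p.1 < p.2].
have CL : all (@seg_le R) C by exact: clamp_seg_le.
have L'S : pairwise (@seg_sep R) L'.
  exact/pairwise_filter/clamp_seg_sep.
have L'nth i : (i < size L')%N ->
    [/\ a <= (nth (0, 0) L' i).1, (nth (0, 0) L' i).1 < (nth (0, 0) L' i).2
      & (nth (0, 0) L' i).2 <= b].
  move=> /(mem_nth (0, 0)); rewrite mem_filter => /andP[-> /mapP[p _ ->]].
  by split => //; [exact: clamp_ge|exact: clamp_le].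
have -> : seg_var (f \o clamp a b) L =
    \sum_(i < size L') `|f (nth (0, 0) L' i).2 - f (nth (0, 0) L' i).1|.
  rewrite -(big_mkord xpredT
    (fun i => `|f (nth (0, 0) L' i).2 - f (nth (0, 0) L' i).1|)).
  rewrite -(big_nth (0, 0) xpredT (fun p : R * R => `|f p.2 - f p.1|)).
  rewrite big_filter big_map /seg_var [RHS]big_mkcond big_seq [RHS]big_seq.
  apply: eq_bigr => p /(allP LL) pL /=; case: ifPn => //; rewrite -leNgt => pp.
  suff -> : clamp a b p.1 = clamp a b p.2 by rewrite subrr normr0.
  by apply/le_anti; rewrite pp clamp_homo.
apply: fd.
- by move=> i; have [] := L'nth _ (ltn_ord i).
- move=> i j _ _ [z []]; rewrite /= !in_itv/= => /andP[iz zi] /andP[jz zj].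
  have sep (k l : 'I_(size L')) : (k < l)%N ->
      ((nth (0, 0) L' k).2 <= (nth (0, 0) L' l).1) ||
      ((nth (0, 0) L' l).2 <= (nth (0, 0) L' k).1).
    move=> kl; have /pairwiseP/(_ k l) := L'S; apply => //; exact: ltn_ord.
  apply/val_inj; case: (ltngtP i j) => // /sep /orP[] h; exfalso;
  by [move: (lt_trans (lt_le_trans zi h) jz); rewrite ltxx
     |move: (lt_trans (lt_le_trans zj h) iz); rewrite ltxx].
- apply: le_lt_trans Ld.
  rewrite -(big_mkord xpredT (fun i => (nth (0, 0) L' i).2 - (nth (0, 0) L' i).1)).
  rewrite -(big_nth (0, 0) xpredT (fun p : R * R => p.2 - p.1)) big_filter.
  apply: le_trans (clamp_seg_length a b LL).
  rewrite /seg_length big_mkcond big_seq [leRHS]big_seq; apply: ler_sum => p.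
  by move=> /(allP CL) pp; case: ifPn => // _; rewrite subr_ge0.
Qed.

Lemma ac_lineB (R : realType) (f g : R -> R) :
  ac_line f -> ac_line g -> ac_line (f \- g).
Proof.
move=> acf acg e e0.
have e20 : 0 < e / 2 by rewrite divr_gt0.
have [d d0 fd] := acf _ e20; have [d' d'0 gd] := acg _ e20.
exists (Num.min d d'); first by rewrite lt_min d0.
move=> L LL LS; rewrite lt_min => /andP[Ld Ld'].
have := ltrD (fd L LL LS Ld) (gd L LL LS Ld'); rewrite -splitr.
apply: le_lt_trans; rewrite /seg_var -big_split; apply: ler_sum => p _ /=.
have -> : f p.2 - g p.2 - (f p.1 - g p.1) =
    (f p.2 - f p.1) - (g p.2 - g p.1) by ring.
exact: ler_normB.
Qed.

(** * Total variation of absolutely continuous functions *)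

Definition partition_segs (R : realType) (x : R) (s : seq R) := zip (x :: s) s.

Section PartitionSegs.
Context {R : realType}.
Implicit Types (x y : R) (s : seq R) (p : R * R).

Lemma partition_segs_var f x y s : itv_partition x y s ->
  variation x y f s = seg_var f (partition_segs x s).
Proof.
move=> xys; rewrite (variation_zip _ xys) /seg_var /partition_segs.
elim: s x {xys} => [|z s ih] x /=; first by rewrite !big_nil.
by rewrite !big_cons ih.
Qed.

Lemma partition_segs_length x y s : itv_partition x y s ->
  seg_length (partition_segs x s) = y - x.
Proof.
rewrite /seg_length /partition_segs.
elim: s x => [|z s ih] x; first by move/itv_partition_nil ->; rewrite big_nil subrr.
by move/itv_partition_cons/ih => /= ; rewrite big_cons => ->/=; ring.
Qed.

Lemma partition_segs_sub x y s p : itv_partition x y s ->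
  p \in partition_segs x s -> [/\ x <= p.1, p.1 <= p.2 & p.2 <= y].
Proof.
rewrite /partition_segs.
elim: s x => [//|z s ih] x; rewrite /= => xys.
have zys := itv_partition_cons xys.
have xz : x <= z by case: xys => /= /andP[/ltW].
have zy := itv_partition_le zys.
rewrite inE => /predU1P[->//=|/(ih _ zys)[zp pp py]].
by split => //; exact: le_trans zp.
Qed.

Lemma partition_segs_sep x y s : itv_partition x y s ->
  pairwise (@seg_sep R) (partition_segs x s).
Proof.
rewrite /partition_segs.
elim: s x => [//|z s ih] x /itv_partition_cons zys; rewrite /=.
apply/andP; split; last exact: ih.
apply/allP => p /(partition_segs_sub zys)[zp _ _].
by rewrite /seg_sep /= zp.
Qed.

End PartitionSegs.

(** On a family of small total length, the increments can be replaced by the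
    total variations over the segments. By induction, the segments of L1 are
    partitioned one at a time: the pieces join the list L2 of segments that are
    measured by their increments, and the supremum over all partitions
    yields the total variation. *)
Lemma ac_mod_total_variation (R : realType) (f : R -> R) (e d : R) :
  ac_mod f e d -> forall L1 L2 : seq (R * R),
  all (@seg_le R) (L1 ++ L2) -> pairwise (@seg_sep R) (L1 ++ L2) ->
  seg_length (L1 ++ L2) < d ->
  (\sum_(p <- L1) total_variation p.1 p.2 f + (seg_var f L2)%:E <= e%:E)%E.
Proof.
move=> fd; elim=> [|p L1 ih] L2.
  by move=> LL LS Ld; rewrite big_nil add0e lee_fin; exact/ltW/fd.
rewrite /= all_cat pairwise_cat => /and3P[pp LL1 LL2].
rewrite all_cat => /andP[/andP[p1 p2] /and3P[L12 LS1 LS2]] Ld.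
rewrite big_cons -addeA.
set X := (\sum_(p <- L1) _ + _)%E.
(* For a partition s of p, the induction hypothesis applies with the pieces of
   s moved into the second list. *)
have key s : itv_partition p.1 p.2 s ->
    ((variation p.1 p.2 f s)%:E + X <= e%:E)%E.
  move=> ps; rewrite (partition_segs_var _ ps).
  have := ih (partition_segs p.1 s ++ L2).
  rewrite seg_var_cat EFinD addeCA; apply.
  - rewrite all_cat LL1/= all_cat LL2 andbT.
    by apply/allP => q /(partition_segs_sub ps)[].
  - have subsep q r : q \in partition_segs p.1 s -> seg_sep p r -> seg_sep q r.
      move=> /(partition_segs_sub ps)[pq _ qp] /orP[pr|rp]; apply/orP.
        by left; exact: le_trans pr.
      by right; exact: le_trans pq.
    rewrite pairwise_cat LS1 allrel_catr L12 andbT pairwise_cat LS2.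
    rewrite (partition_segs_sep ps) /= andbT; apply/andP; split; last first.
      apply/allrelP => q r qs rL2; apply: subsep qs _; exact: (allP p2).
    apply/allrelP => r q rL1 qs; rewrite /seg_sep orbC.
    by apply: subsep qs _; exact: (allP p1).
  - rewrite !seg_length_cat (partition_segs_length ps).
    by move: Ld; rewrite -cat1s !seg_length_cat {1}/seg_length big_seq1 addrCA.
have X0 : (0 <= X)%E.
  apply: adde_ge0; last by rewrite lee_fin; apply: sumr_ge0.
  rewrite big_seq; apply: sume_ge0 => q /(allP LL1); exact: total_variation_ge0.
have Xfin : X \is a fin_num.
  rewrite ge0_fin_numE//.
  suff : (X <= e%:E)%E by move/le_lt_trans; apply; rewrite ltry.
  move: pp; rewrite /seg_le le_eqVlt => /orP[/eqP pE|plt].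
    have /key : itv_partition p.1 p.2 [::] by split => //=; rewrite pE.
    by rewrite variation_nil add0e.
  apply: le_trans (key _ (itv_partition1 plt)).
  by rewrite leeDr// lee_fin variation_ge0.
rewrite -leeBrDr//; apply: ge_ereal_sup => _ [_ [s ps <-] <-].
by rewrite leeBrDr// key.
Qed.

(** The variation is at most 1 on segments shorter than the modulus d of 1,
    and finitely many of these cover [x, y]. *)
Lemma ac_line_total_variation_fin (R : realType) (f : R -> R) (x y : R) :
  ac_line f -> x <= y -> total_variation x y f \is a fin_num.
Proof.
move=> acf; have [d d0 fd] := acf _ ltr01.
have short u w : u <= w -> w - u < d -> total_variation u w f \is a fin_num.
  move=> uw uwd; rewrite ge0_fin_numE ?total_variation_ge0//.
  have := ac_mod_total_variation fd (L1 := [:: (u, w)]) (L2 := [::]).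
  rewrite /= /seg_le /= uw /seg_length /seg_var !big_seq1 big_nil adde0.
  by move=> /(_ isT isT uwd) /le_lt_trans; apply; rewrite ltry.
have d20 : 0 < d / 2 by rewrite divr_gt0.
suff fin n : forall z, x <= z -> z - x <= n%:R * (d / 2) ->
    total_variation x z f \is a fin_num.
  move=> xy; apply: (fin (Num.bound ((y - x) / (d / 2)))) => //.
  rewrite -ler_pdivrMr//; apply/ltW/archi_boundP.
  by rewrite divr_ge0 ?subr_ge0// ltW.
elim: n => [|n ih] z xz.
  rewrite mul0r subr_le0 => zx.
  have -> : z = x by apply/le_anti; rewrite xz zx.
  by rewrite total_variationxx.
rewrite -natr1 mulrDl mul1r => zn.
have [/ih|zx] := leP (z - x) (n%:R * (d / 2)); first exact.
have nd0 : 0 <= n%:R * (d / 2) by rewrite mulr_ge0// ltW.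
rewrite (@total_variationD _ x z (x + n%:R * (d / 2))); [|by lra|by lra].
by rewrite fin_numD ih ?short//; lra.
Qed.

(** The majorant v is the total variation of f from a. Both v and, by the last
    clause, v - f are nondecreasing, so that measures can be attached to them. *)
Lemma ac_line_majorant (R : realType) (a b : R) (f : R -> R) :
  a <= b -> ac_line f -> exists v : R -> R,
  [/\ ac_line v, {homo v : x y / x <= y} &
      forall x y, x <= y -> f (clamp a b y) - f (clamp a b x) <= v y - v x].
Proof.
move=> ab acf; pose v x := fine (total_variation a (clamp a b x) f).
have aC x : a <= clamp a b x by exact: clamp_ge.
have tvfin x y : x <= y ->
    total_variation (clamp a b x) (clamp a b y) f \is a fin_num.
  by move=> xy; exact/(ac_line_total_variation_fin acf)/clamp_homo.
have vE x y : x <= y ->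
    (v y - v x)%:E = total_variation (clamp a b x) (clamp a b y) f.
  move=> xy; have av z := ac_line_total_variation_fin acf (aC z).
  rewrite EFinB /v !fineK// (total_variationD f (aC x) (clamp_homo a b xy)).
  by rewrite addeAC subee// add0e.
exists v; split=> [e e0|x y xy|x y xy]; last 2 first.
- rewrite -subr_ge0 -lee_fin vE//.
  exact/total_variation_ge0/clamp_homo.
- rewrite -lee_fin vE//.
  apply: le_trans (total_variation_ge _ (clamp_homo a b xy)).
  by rewrite lee_fin ler_norm.
have e20 : 0 < e / 2 by rewrite divr_gt0.
have [d d0 fd] := acf _ e20; exists d => // L LL LS Ld.
apply: (@le_lt_trans _ _ (e / 2)); last by lra.
have := ac_mod_total_variation fd (L1 := map (clamp_seg a b) L) (L2 := [::]).
rewrite cats0 clamp_seg_le// clamp_seg_sep//.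
move=> /(_ isT isT (le_lt_trans (clamp_seg_length a b LL) Ld)).
rewrite /seg_var big_nil adde0 big_map -lee_fin; apply: le_trans.
rewrite -sumEFin big_seq [leRHS]big_seq; apply: lee_sum => p /(allP LL) pp.
rewrite ger0_norm ?vE//= -lee_fin vE//.
exact/total_variation_ge0/clamp_homo.
Qed.

(** * Densities of absolutely continuous functions *)

(** The half-open hull is the shape on which a Stieltjes measure is given by a
    difference of values; an open interval misses its infimum, so it lies in
    this hull. *)
Lemma open_interval_hull (R : realType) (A B : R) (I : set R) :
  open I -> is_interval I -> I `<=` `]A, B[ -> I !=set0 ->
  exists p : R * R, [/\ p.1 < p.2, I `<=` `]p.1, p.2] & `]p.1, p.2[ `<=` I].
Proof.
move=> oI iI IAB I0.
have hi : has_inf I.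
  by split => //; exists A => t /IAB; rewrite /= in_itv/= => /andP[/ltW].
have hs : has_sup I.
  by split => //; exists B => t /IAB; rewrite /= in_itv/= => /andP[_ /ltW].
have sub : I `<=` `]inf I, sup I].
  move=> z Iz; rewrite /= in_itv/=; apply/andP; split; last first.
    exact: sup_upper_bound.
  have [r /= r0 zr] := oI _ Iz.
  have /zr Izr : ball_ Num.norm z r (z - r / 2).
    by rewrite /ball_/= opprB addrC subrK gtr0_norm; lra.
  apply: (@le_lt_trans _ _ (z - r / 2)); last by lra.
  exact: inf_lbound hi.2 _ Izr.
exists (inf I, sup I); split => //=.
  by case: I0 => t /sub; rewrite /= in_itv/= => /andP[]; exact: lt_le_trans.
move=> z; rewrite /= in_itv/= => /andP[iz zs].
have [u Iu uz] := inf_lt hi.1 iz.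
have [w Iw zw] := sup_gt hs.1 zs.
by apply: (iI u w) => //; rewrite !ltW.
Qed.

Lemma stieltjes_itv_oc (R : realType) (h : cumulative R R) (x y : R) :
  x <= y -> lebesgue_stieltjes_measure h `]x, y] = (h y - h x)%:E.
Proof.
move=> xy; rewrite /lebesgue_stieltjes_measure/= /measure_extension.
rewrite measurable_mu_extE/=; last exact: is_ocitv.
by rewrite wlength_itv_bnd.
Qed.

(** An open set is a disjoint union of countably many open intervals. Every
    finite subfamily is a family of segments of total length less than d, on
    which h increases by less than e. *)
Lemma stieltjes_open_small (R : realType) (h : cumulative R R) (e d A B : R)
    (U : set R) : ac_mod h e d -> open U -> U `<=` `]A, B[ ->
  (@lebesgue_measure R U < d%:E)%E ->
  (lebesgue_stieltjes_measure h U <= e%:E)%E.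
Proof.
move=> hd oU UAB Ud.
pose I := open_disjoint_itv oU.
have oI k : open (I k) by exact: open_disjoint_itv_open.
have mI k : measurable (I k) by exact: open_measurable.
have tI : trivIset setT I by exact: open_disjoint_itv_trivIset.
have UE : U = \bigcup_k I k by exact: open_disjoint_itv_bigcup.
have IU k : I k `<=` U by rewrite UE; exact: bigcup_sup.
have /choice[p pI] : forall k, exists q : R * R, I k !=set0 ->
    [/\ q.1 < q.2, I k `<=` `]q.1, q.2] & `]q.1, q.2[ `<=` I k].
  move=> k; have kU := subset_trans (IU k) UAB.
  have [I0|I0] := pselect (I k !=set0); last by exists (0, 0).
  have [q Hq] := open_interval_hull (oI k)
    (@open_disjoint_itv_is_interval _ _ oU k) kU I0.
  by exists q.
rewrite [in leLHS]UE measure_bigcup//=; last by move=> ? _; exact: mI.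
apply: lime_le; first exact: is_cvg_nneseries.
apply: nearW => n.
pose N := [seq k <- index_iota 0 n | `[< I k !=set0 >]].
pose L := map p N.
have NI k : k \in N -> I k !=set0.
  by rewrite mem_filter => /andP[/asboolP].
have LL : all (@seg_le R) L.
  rewrite all_map; apply/allP => k /NI /pI[p12 _ _]; exact: ltW.
have LS : pairwise (@seg_sep R) L.
  rewrite pairwise_map.
  have : pairwise (fun i j : nat => i != j) N.
    by rewrite -uniq_pairwise filter_uniq// iota_uniq.
  apply: (@sub_in_pairwise _ (mem N)); last exact/allP.
  move=> i j /NI /pI[i12 _ iI] /NI /pI[j12 _ jI] ij.
  rewrite /relpre/= /seg_sep; apply: contraNT ij; rewrite negb_or -!ltNge.
  move=> /andP[ji ij]; apply/eqP/(tI i j) => //.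
  pose l := Num.max (p i).1 (p j).1; pose r := Num.min (p i).2 (p j).2.
  have lr : l < r by rewrite /l /r lt_min !gt_max i12 j12 ij ji.
  exists ((l + r) / 2).
  (* otherwise the interiors would overlap on ]l, r[ *)
  have [lz zr] := midf_lt lr.
  have [lz1 lz2] : (p i).1 <= l /\ (p j).1 <= l by rewrite /l !le_max !lexx orbT.
  have [rz1 rz2] : r <= (p i).2 /\ r <= (p j).2 by rewrite /r !ge_min !lexx orbT.
  split; [apply: iI|apply: jI]; rewrite /= in_itv/=; lra.
have Ld : seg_length L < d.
  rewrite -lte_fin; apply: le_lt_trans Ud.
  rewrite UE measure_bigcup//=; last by move=> ? _; exact: mI.
  apply: le_trans (nneseries_lim_ge n _) => //.
  rewrite /seg_length big_map big_filter big_mkcond/= -sumEFin.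
  under [leRHS]eq_bigl do rewrite in_setT.
  apply: lee_sum => k _; case: asboolP => [/pI[p12 _ pIk]|_]; last by [].
  rewrite -(_ : lebesgue_measure `](p k).1, (p k).2[ = ((p k).2 - (p k).1)%:E).
    by apply: le_measure; rewrite ?inE//; exact: mI.
  by rewrite lebesgue_measure_itv/= lte_fin p12.
apply: (@le_trans _ _ (seg_var h L)%:E); last by rewrite lee_fin; exact/ltW/hd.
rewrite /seg_var big_map big_filter [in leRHS]big_mkcond/= -sumEFin.
under eq_bigl do rewrite in_setT.
apply: lee_sum => k _; case: asboolP => [/pI[p12 Ikp _]|Ik0]; last first.
  by rewrite (_ : I k = set0) ?measure0//; apply: contra_notP Ik0 => /eqP/set0P.
apply: (@le_trans _ _ ((h (p k).2 - h (p k).1)%:E)); last first.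
  by rewrite lee_fin ler_norm.
rewrite -(stieltjes_itv_oc h (ltW p12)).
by apply: le_measure; rewrite ?inE//; exact: mI.
Qed.

Lemma ac_line_continuous (R : realType) (f : R -> R) : ac_line f -> continuous f.
Proof.
move=> acf x; apply/cvgrPdist_lt => e /acf[d d0 fd].
have step u w : u <= w -> w - u < d -> `|f w - f u| < e.
  move=> uw uwd; have := fd [:: (u, w)].
  by rewrite /seg_length /seg_var !big_seq1/= /seg_le uw => /(_ isT isT uwd).
exists d => //= y; rewrite /ball_/= => xy.
have [xy'|/ltW yx'] := leP x y.
  by rewrite distrC step// -(ger0_norm (_ : 0 <= y - x)) ?subr_ge0// distrC.
by rewrite step// -(ger0_norm (_ : 0 <= x - y)) ?subr_ge0.
Qed.

Lemma clamp_continuous (R : realType) (a b : R) :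
  a <= b -> continuous (clamp a b).
Proof.
move=> ab; apply: ac_line_continuous.
have acid : abs_continuous a b id.
  move=> e e0; exists e => // n x y xy _; apply: le_lt_trans.
  by apply: ler_sum => i _; rewrite ger0_norm ?subr_ge0// ltW//; case: (xy i) => _ [].
exact: (ac_line_clamp ab acid).
Qed.

(** By outer regularity, a null set lies in open sets of arbitrarily small
    length, and these have small Stieltjes measure. Intersecting with
    ]a - 1, b + 1[ makes the intervals of such an open set bounded. *)
Lemma ac_stieltjes_null (R : realType) (h : cumulative R R) (a b : R)
    (A : set R) : ac_line h -> measurable A -> A `<=` `]a, b] ->
  @lebesgue_measure R A = 0%E -> lebesgue_stieltjes_measure h A = 0%E.
Proof.
move=> ach mA Aab A0; apply/eqP; rewrite eq_le measure_ge0 andbT.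
apply/lee_addgt0Pr => e e0; rewrite add0e.
have [d d0 hd] := ach _ e0.
have Aoo : (@lebesgue_measure R A < +oo)%E by rewrite A0 ltry.
have [U [oU AU Ud]] := lebesgue_regularity_outer mA Aoo d0.
pose V := U `&` `](a - 1), (b + 1)[.
have oV : open V by apply: openI => //; exact: interval_open.
have AV : A `<=` V.
  move=> x Ax; split; first exact: AU.
  have := Aab _ Ax; rewrite /= !in_itv/=; lra.
have mV : measurable V by exact: measurable_realfun.open_measurable.
apply: (@le_trans _ _ (lebesgue_stieltjes_measure h V)).
  by apply: le_measure; rewrite ?inE//; exact: mA.
apply: (stieltjes_open_small hd oV (A := a - 1) (B := b + 1)); first by move=> x [].
apply: le_lt_trans Ud.
have -> : V = A `|` (V `\` A) by rewrite setDUK.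
rewrite measureU//; last 2 first.
- exact: measurableD.
- by rewrite setDIK.
rewrite [X in (X + _)%E]A0 add0e; apply: le_measure; rewrite ?inE.
- exact: measurableD.
- by apply: measurableD => //; exact: measurable_realfun.open_measurable.
- by apply: setSD => x [].
Qed.

(** Radon-Nikodym theorem for the Stieltjes measure of h; the measure is
    restricted to ]a, b] to make it finite. *)
Lemma nondecreasing_ac_density (R : realType) (a b : R) (h : R -> R) :
  a <= b -> ac_line h -> {homo h : x y / x <= y} ->
  exists g : R -> R,
  (@lebesgue_measure R).-integrable setT (EFin \o g) /\
  forall x, a <= x <= b ->
    (\int[@lebesgue_measure R]_(t in `]a, x]) (g t)%:E = (h x - h a)%:E)%E.
Proof.
move=> ab ach ndh.
have rch : right_continuous h.
  exact/right_continuousW/ac_line_continuous.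
pose H : cumulative R R := HB.pack h (isCumulative.Build R _ R h ndh rch).
pose mH := lebesgue_stieltjes_measure H.
have mab : measurable (`]a, b]%classic : set (measurableTypeR R)).
  exact: measurable_itv.
have mHab : (mH `]a, b]%classic < +oo)%E by rewrite /mH stieltjes_itv_oc// ltry.
pose nu := charge_of_finite_measure (mfrestr mab mHab).
have dom : nu `<< @lebesgue_measure R.
  apply/null_content_dominatesP => A mA A0.
  rewrite /nu /charge_of_finite_measure/= /mfrestr /mrestr.
  apply: (@ac_stieltjes_null _ H a b) => //.
    exact: measurableI.
  apply/eqP; rewrite eq_le measure_ge0 andbT -A0.
  by apply: le_measure; rewrite ?inE//; exact: measurableI.
pose G := Radon_Nikodym nu (@lebesgue_measure R).
have GE t : (fine (G t))%:E = G t by rewrite fineK// Radon_Nikodym_fin_num.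
exists (fine \o G); split.
  rewrite (_ : EFin \o (fine \o G) = G); last exact/funext.
  exact: Radon_Nikodym_integrable.
move=> x /andP[ax xb].
under eq_integral do rewrite GE.
rewrite -Radon_Nikodym_integral//.
rewrite /nu /charge_of_finite_measure/= /mfrestr /mrestr.
rewrite setIidl; last first.
  by move=> t; rewrite /= !in_itv/= => /andP[-> tx]; exact: le_trans xb.
exact: stieltjes_itv_oc.
Qed.

(** * The fundamental theorem of calculus *)

Section AbsolutelyContinuousFTC.
Context {R : realType} (a b : R) (F : R -> R).
Hypotheses (ab : a < b) (acF : abs_continuous a b F).
Local Notation mu := (@lebesgue_measure R).

(** F is the difference of the nondecreasing functions v and v - F. *)
Lemma abs_continuous_density : exists g : R -> R,
  mu.-integrable setT (EFin \o g) /\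
  forall x, a <= x <= b ->
    (\int[mu]_(t in `]a, x]) (g t)%:E = (F x - F a)%:E)%E.
Proof.
have ab' := ltW ab.
have acFc := ac_line_clamp ab' acF.
have [v [acv ndv Fv]] := ac_line_majorant ab' acFc.
have ndw : {homo (v \- (F \o clamp a b)) : x y / x <= y}.
  move=> x y xy /=; have := Fv x y xy; rewrite /= !clampK//.
  by lra.
have [g1 [ig1 g1E]] := nondecreasing_ac_density ab' acv ndv.
have [g2 [ig2 g2E]] := nondecreasing_ac_density ab' (ac_lineB acv acFc) ndw.
exists (g1 \- g2); split.
  have := integrableB measurableT ig1 ig2.
  by apply: eq_integrable => //.
move=> x axb; under eq_integral do rewrite /= EFinB.
rewrite integralB_EFin//; [|exact: integrableS ig1|exact: integrableS ig2].
rewrite g1E// g2E// -EFinB /= !clamp_id ?lexx ?ab' //.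
by congr EFin; ring.
Qed.

(** Near a point of ]a, b[ the function F differs by a constant from an
    indefinite integral of g, whose derivative is g at almost every point. *)
Lemma abs_continuous_deriv (g : R -> R) :
  mu.-integrable setT (EFin \o g) ->
  (forall x, a <= x <= b ->
    (\int[mu]_(t in `]a, x]) (g t)%:E = (F x - F a)%:E)%E) ->
  {ae mu, forall x, x \in `]a, b[ -> derivable F x 1 /\ derive1 F x = g x}.
Proof.
move=> ig gE.
have lg : locally_integrable setT g.
  by have := integrable_locally measurableT ig; rewrite patch_setT.
have ig' y : mu.-integrable [set` Interval (BRight a) (BRight y)] (EFin \o g).
  exact: integrableS ig.
have := FTC1 ig' lg; apply: filterS; first exact: (ae_filter_ringOfSetsType mu).
move=> x H xab.
have near_eq : {near x, (fun y => \int[mu]_(t in `]a, y]) g t) =1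
    (fun y => F y - F a)}.
  have := near_in_itvoo xab; apply: filterS => y yab.
  rewrite /Rintegral gE//=; move: yab; rewrite in_itv/= => /andP[ay yb].
  by rewrite !ltW.
have ax : (BRight a < BRight x)%O.
  by move: xab; rewrite in_itv/= => /andP[ax _]; rewrite bnd_simp.
have [dG GE] := H ax.
have dFa := near_eq_derivable near_eq dG.
have FE : F = (fun y => F y - F a) \+ cst (F a).
  by apply/funext => y /=; rewrite subrK.
have dF : derivable F x 1.
  by rewrite FE; apply: derivableD => //; exact: derivable_cst.
split => //; rewrite -GE !derive1E (near_eq_derive _ near_eq).
by rewrite [in LHS]FE deriveD// derive_cst addr0.
Qed.

End AbsolutelyContinuousFTC.

(** The function k stands for the derivative and is prescribed only where F is
    differentiable in ]a, b[, which is almost everywhere. Being measurable, it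
    can replace the density in integrals, whereas the derivative itself takes
    uncontrolled values on a null set. *)
Lemma abs_continuous_integral_deriv {R : realType} (a b : R) (F k : R -> R) :
  a < b -> abs_continuous a b F ->
  measurable_fun (`[a, b] : set R) k ->
  (forall x, x \in `]a, b[ -> derivable F x 1 -> derive1 F x = k x) ->
  (@lebesgue_measure R).-integrable `[a, b] (EFin \o k) /\
  forall x y, a <= x -> x <= y -> y <= b ->
    \int[@lebesgue_measure R]_(t in `[x, y]) k t = F y - F x.
Proof.
move=> ab acF mk Fk.
have [g [ig gE]] := abs_continuous_density ab acF.
have Fg := abs_continuous_deriv ig gE.
have neq c : {ae @lebesgue_measure R, forall x : R, x != c}.
  exists [set c]; split => //=; first exact: lebesgue_measure_set1.
  by move=> x /= /negP; rewrite negbK => /eqP.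
have mab : measurable (`[a, b]%classic : set (measurableTypeR R)).
  exact: measurable_itv.
have gk : ae_eq (@lebesgue_measure R) `[a, b]%classic (EFin \o g) (EFin \o k).
  apply: filterS3 Fg (neq a) (neq b).
    exact: (ae_filter_ringOfSetsType (@lebesgue_measure R)).
  move=> x Fgx xa xb; rewrite /= in_itv/= => /andP[ax xb'].
  have xab : x \in `]a, b[ by rewrite in_itv/= !lt_neqAle eq_sym xa ax xb xb'.
  by have [dF <-] := Fgx xab; rewrite Fk.
have ig' : (@lebesgue_measure R).-integrable `[a, b] (EFin \o g).
  exact: integrableS ig.
have mk' : measurable_fun (`[a, b] : set R) (EFin \o k) by exact/measurable_EFinP.
have ik : (@lebesgue_measure R).-integrable `[a, b] (EFin \o k).
  apply/integrableP; split=> //.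
  have /integrableP[mg] := ig'; apply: le_lt_trans.
  rewrite le_eqVlt; apply/orP; left; apply/eqP.
  apply: ae_eq_integral => //; [exact: measurableT_comp|exact: measurableT_comp|].
  exact/ae_eq_sym/ae_eq_abse.
have intE x : a <= x -> x <= b ->
    \int[@lebesgue_measure R]_(t in `]a, x]) k t = F x - F a.
  move=> ax xb; have sub : `]a, x]%classic `<=` (`[a, b]%classic : set R).
    by move=> t; rewrite /= !in_itv/= => /andP[at_ tx]; rewrite ltW//= (le_trans tx).
  suff kgE : (\int[@lebesgue_measure R]_(t in `]a, x]) (k t)%:E =
      \int[@lebesgue_measure R]_(t in `]a, x]) (g t)%:E)%E.
    by rewrite /Rintegral kgE gE// ax.
  apply: ae_eq_integral => //.
  - exact: measurable_funS mk'.
  - by have /integrableP[+ _] := ig'; exact: measurable_funS.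
  - by apply: filterS gk => t gkt /sub /gkt /esym.
split=> // x y ax xy yb.
have iky : (@lebesgue_measure R).-integrable `]a, y] (EFin \o k).
  apply: integrableS ik => // t; rewrite /= !in_itv/= => /andP[at_ tx].
  by rewrite ltW//= (le_trans tx).
rewrite -Rintegral_itv_obnd_cbnd; last first.
  apply: integrableS ik => // t; rewrite /= !in_itv/= => /andP[at_ tx].
  by rewrite (le_trans tx)// andbT ltW// (le_lt_trans ax).
rewrite -(Rintegral_itvB iky) ?bnd_simp//.
by rewrite !intE ?(le_trans xy) ?(le_trans ax)//; ring.
Qed.

(** * Cauchy-Schwarz inequality and integrals over a segment *)

Lemma integrable_mul_sqr d (T : measurableType d) (R : realType)
    (mu : {measure set T -> \bar R}) (D : set T) (u v : T -> R) :
  measurable D -> measurable_fun D u -> measurable_fun D v ->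
  mu.-integrable D (EFin \o (fun x => u x ^+ 2)) ->
  mu.-integrable D (EFin \o (fun x => v x ^+ 2)) ->
  mu.-integrable D (EFin \o (fun x => u x * v x)).
Proof.
move=> mD mu_ mv iu iv.
apply: le_integrable (integrableD mD iu iv) => //.
  by apply/measurable_EFinP; exact: measurable_funM.
move=> x _ /=; rewrite lee_fin [leRHS]ger0_norm ?addr_ge0 ?sqr_ge0//.
rewrite ler_norml; apply/andP; split; nra.
Qed.

(** The quadratic form (s, t) |-> int (s u + t v)^2 is nonnegative, so its
    discriminant is nonpositive. *)
Lemma Rintegral_Cauchy_Schwarz d (T : measurableType d) (R : realType)
    (mu : {measure set T -> \bar R}) (D : set T) (u v : T -> R) :
  measurable D -> measurable_fun D u -> measurable_fun D v ->
  mu.-integrable D (EFin \o (fun x => u x ^+ 2)) ->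
  mu.-integrable D (EFin \o (fun x => v x ^+ 2)) ->
  (\int[mu]_(x in D) (u x * v x)) ^+ 2 <=
  (\int[mu]_(x in D) (u x ^+ 2)) * (\int[mu]_(x in D) (v x ^+ 2)).
Proof.
move=> mD mu_ mv iu iv.
have iuv := integrable_mul_sqr mD mu_ mv iu iv.
set A := \int[mu]_(x in D) (u x ^+ 2); set C := \int[mu]_(x in D) (v x ^+ 2).
set B := \int[mu]_(x in D) (u x * v x).
have Q s t : 0 <= s ^+ 2 * A + (2 * s * t) * B + t ^+ 2 * C.
  have iZ r (h : T -> R) : mu.-integrable D (EFin \o h) ->
      mu.-integrable D (EFin \o (fun x => r * h x)).
    by move=> ih; exact: (integrableZl mD r ih).
  have -> : s ^+ 2 * A + (2 * s * t) * B + t ^+ 2 * C =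
      \int[mu]_(x in D) (s * u x + t * v x) ^+ 2.
    rewrite -!RintegralZl// -RintegralD ?iZ// -RintegralD ?iZ//.
      by apply: eq_Rintegral => x _; ring.
    exact: (integrableD mD (iZ _ _ iu) (iZ _ _ iuv)).
  by apply: Rintegral_ge0 => x _; exact: sqr_ge0.
have C0 : 0 <= C by have := Q 0 1; lra.
have [C_eq0|C_neq0] := eqVneq C 0; last first.
  have Cgt0 : 0 < C by rewrite lt_def C_neq0.
  have := Q C (- B).
  have -> : C ^+ 2 * A + 2 * C * - B * B + (- B) ^+ 2 * C = C * (A * C - B ^+ 2) by ring.
  by rewrite pmulr_rge0// subr_ge0.
have [B0|B0] := eqVneq B 0; first by rewrite B0 C_eq0 mulr0 expr0n.
(* here the form is s^2 A + 2 s t B, which takes the value -1 at this point *)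
have := Q 1 (- (A + 1) / (2 * B)).
have -> : 1 ^+ 2 * A + 2 * 1 * (- (A + 1) / (2 * B)) * B +
    (- (A + 1) / (2 * B)) ^+ 2 * C = -1 by rewrite C_eq0; field.
by lra.
Qed.

Section SegmentIntegrals.
Context {R : realType}.
Local Notation mu := (@lebesgue_measure R).

Lemma continuous_integrable_segment (x y : R) (f : R -> R) :
  continuous f -> mu.-integrable `[x, y] (EFin \o f).
Proof.
move=> cf; apply: continuous_compact_integrable; first exact: segment_compact.
exact: continuous_subspaceT.
Qed.

Lemma Rintegral_is_derive (x y : R) (G g : R -> R) : x <= y -> continuous g ->
  (forall t, is_derive t (1 : R) G (g t)) -> \int[mu]_(t in `[x, y]) g t = G y - G x.
Proof.
rewrite le_eqVlt => /predU1P[-> _ _|xy cg dG].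
  by rewrite set_itv1 Rintegral_set1 subrr.
have cG : continuous G.
  move=> t; apply/differentiable_continuous/derivable1_diffP.
  by have [] := dG t.
rewrite /Rintegral (@continuous_FTC2 _ g G x y) //.
- exact: continuous_subspaceT.
- split; first by move=> t _; have [] := dG t.
  + exact/cvg_at_right_filter/cG.
  + exact/cvg_at_left_filter/cG.
- by move=> t _; rewrite derive1E; have [_ ->] := dG t.
Qed.

Lemma Rintegral_sqr (x y : R) : x <= y ->
  \int[mu]_(t in `[x, y]) t ^+ 2 = (y ^+ 3 - x ^+ 3) / 3.
Proof.
move=> xy.
have dG t : is_derive t (1 : R) (fun t : R => 3^-1 * t ^+ 3) (t ^+ 2).
  by apply: is_derive_eq; rewrite /GRing.scale/=; field.
rewrite (Rintegral_is_derive xy _ dG); first by field.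
exact: exprn_continuous.
Qed.

End SegmentIntegrals.

(** * The Pompeiu-Chebyshev form *)

Section PompeiuForm.
Context {R : realType} (a b : R) (ab : a <= b).
Local Notation mu := (@lebesgue_measure R).
Local Notation I f := (\int[mu]_(x in `[a, b]) f x).
Implicit Types u v : R -> R.

Let cM u v : continuous u -> continuous v -> continuous (fun x => u x * v x).
Proof. by move=> cu cv x; apply: continuousM; [exact: cu|exact: cv]. Qed.

Let cZ (c : R) u : continuous u -> continuous (fun x => c * u x).
Proof. by apply: cM; exact: cst_continuous. Qed.

Let cB u v : continuous u -> continuous v -> continuous (fun x => u x - v x).
Proof. by move=> cu cv x; apply: continuousB; [exact: cu|exact: cv]. Qed.

Let cid : continuous (fun x : R => x). Proof. by move=> x; exact: cvg_id. Qed.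

Let ci u : continuous u -> mu.-integrable `[a, b] (EFin \o u).
Proof. exact: continuous_integrable_segment. Qed.

Let IZ (c : R) u : continuous u -> I (fun x => c * u x) = c * I u.
Proof. by move=> cu; rewrite RintegralZl//; exact: ci. Qed.

Let IB u v : continuous u -> continuous v -> I (fun x => u x - v x) = I u - I v.
Proof. by move=> cu cv; rewrite RintegralB//; exact: ci. Qed.

Let Ixx : I (fun x => x * x) = (b ^+ 3 - a ^+ 3) / 3.
Proof. by rewrite -Rintegral_sqr//; apply: eq_Rintegral => x _; rewrite expr2. Qed.

Let I_shift u v (c d : R) : continuous u -> continuous v ->
  I (fun x => (u x - c * x) * (v x - d * x)) =
  I (fun x => u x * v x) - d * I (fun x => x * u x) -
  c * I (fun x => x * v x) + c * d * ((b ^+ 3 - a ^+ 3) / 3).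
Proof.
move=> cu cv; rewrite -Ixx.
transitivity (I (fun x => (u x * v x - d * (x * u x)) -
    (c * (x * v x) - c * d * (x * x)))).
  by apply: eq_Rintegral => x _; ring.
have [cuv cxu cxv cxx] := And4 (cM cu cv) (cM cid cu) (cM cid cv) (cM cid cid).
by rewrite !IB ?IZ; [ring|do ?[exact: cxx|exact: cxu|exact: cxv|exact: cuv
  |apply: cB|apply: cZ]..].
Qed.

Let Ix_shift u (c : R) : continuous u ->
  I (fun x => x * (u x - c * x)) =
  I (fun x => x * u x) - c * ((b ^+ 3 - a ^+ 3) / 3).
Proof.
move=> cu; rewrite -Ixx -IZ; last exact: cM.
rewrite -IB; [|exact: cM|exact/cZ/cM].
by apply: eq_Rintegral => x _; ring.
Qed.

(** The function x lies in the kernel of the form, because W is the integral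
    of x^2. *)
Lemma pompeiu_chebyshev_shift u v (c d : R) : continuous u -> continuous v ->
  pompeiu_chebyshev a b (fun x => u x - c * x) (fun x => v x - d * x) =
  pompeiu_chebyshev a b u v.
Proof.
move=> cu cv; rewrite /pompeiu_chebyshev I_shift// !Ix_shift//.
set W := (_ - _) / 3. ring.
Qed.

(** If w is the orthogonal projection of u onto the complement of x, then
    P(u, v) is W times the scalar product of w and v, and w is not longer
    than u. *)
Lemma pompeiu_chebyshev_le u v : a < b -> 0 <= a -> continuous u -> continuous v ->
  pompeiu_chebyshev a b u v ^+ 2 <=
  ((b ^+ 3 - a ^+ 3) / 3) ^+ 2 * (I (fun x => u x ^+ 2) * I (fun x => v x ^+ 2)).
Proof.
move=> altb a0 cu cv; set W := (b ^+ 3 - a ^+ 3) / 3.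
have W0 : 0 < W by rewrite divr_gt0// subr_gt0 ltr_pXn2r ?nnegrE// (le_trans a0).
pose p := I (fun x => x * u x) / W.
pose w x := u x - p * x.
have cw : continuous w by apply: cB => //; exact: cZ.
have PE : pompeiu_chebyshev a b u v = W * I (fun x => w x * v x).
  have -> : I (fun x => w x * v x) = I (fun x => (u x - p * x) * (v x - 0 * x)).
    by apply: eq_Rintegral => x _; rewrite mul0r subr0.
  rewrite I_shift// /pompeiu_chebyshev -/W /p; field; exact: lt0r_neq0.
have sqrE h : I (fun x => h x ^+ 2) = I (fun x => h x * h x).
  by apply: eq_Rintegral => x _; rewrite expr2.
have wu : I (fun x => w x ^+ 2) <= I (fun x => u x ^+ 2).
  rewrite !sqrE /w I_shift// -/W -/p.
  have -> : I (fun x => x * u x) = p * W by rewrite /p divfK// lt0r_neq0.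
  have := mulr_ge0 (sqr_ge0 p) (ltW W0); nra.
rewrite PE exprMn ler_wpM2l ?sqr_ge0//.
have mI (h : R -> R) : continuous h -> measurable_fun (`[a, b]%classic : set (measurableTypeR R)) h.
  by move=> ch; apply: measurable_funTS; exact: continuous_measurable_fun.
have c2 (h : R -> R) : continuous h -> continuous (fun x => h x ^+ 2).
  by move=> ch x; apply: (cM ch ch).
have mab : measurable (`[a, b]%classic : set (measurableTypeR R)).
  exact: measurable_itv.
have := Rintegral_Cauchy_Schwarz (mu := mu) mab (mI _ cw) (mI _ cv).
move=> /(_ (ci (c2 _ cw)) (ci (c2 _ cv))) /le_trans; apply.
by apply: ler_wpM2r => //; apply: Rintegral_ge0 => x _; exact: sqr_ge0.
Qed.

End PompeiuForm.

(** * A Poincare inequality centred at the midpoint *)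

Section Poincare.
Context {R : realType}.
Local Notation mu := (@lebesgue_measure R).

Lemma Rintegral_segment_split (x m y : R) (k : R -> R) : x <= m -> m <= y ->
  mu.-integrable `[x, y] (EFin \o k) ->
  \int[mu]_(t in `[x, y]) k t =
  \int[mu]_(t in `[x, m]) k t + \int[mu]_(t in `[m, y]) k t.
Proof.
move=> xm my ik.
have ik' : mu.-integrable `]m, y] (EFin \o k).
  apply: integrableS ik => // t; rewrite /= !in_itv/= => /andP[mt ->].
  by rewrite andbT ltW// (le_lt_trans xm).
by rewrite -(Rintegral_itv_obnd_cbnd ik') -(Rintegral_itvB ik) ?bnd_simp// addrC subrK.
Qed.

(** Cauchy-Schwarz for the integral of k = k * 1 over [x, y]. *)
Lemma sqr_increment_le (a b : R) (F k : R -> R) : a < b ->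
  abs_continuous a b F -> measurable_fun (`[a, b] : set R) k ->
  (forall x, x \in `]a, b[ -> derivable F x 1 -> derive1 F x = k x) ->
  mu.-integrable `[a, b] (EFin \o (fun t => k t ^+ 2)) ->
  forall x y, a <= x -> x <= y -> y <= b ->
  (F y - F x) ^+ 2 <= (y - x) * \int[mu]_(t in `[x, y]) k t ^+ 2.
Proof.
move=> ab acF mk Fk ik2 x y ax xy yb.
have [ik kE] := abs_continuous_integral_deriv ab acF mk Fk.
have sub : `[x, y]%classic `<=` (`[a, b]%classic : set R).
  by move=> t; rewrite /= !in_itv/= => /andP[xt ty]; rewrite (le_trans ax)//= (le_trans ty).
have mxy : measurable (`[x, y]%classic : set (measurableTypeR R)).
  exact: measurable_itv.
have c1 : continuous (fun _ : R => 1 : R) by exact: cst_continuous.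
have := Rintegral_Cauchy_Schwarz (mu := mu) mxy (u := k) (v := fun _ => 1).
have -> : \int[mu]_(t in `[x, y]) (k t * 1) = F y - F x.
  by rewrite -kE//; apply: eq_Rintegral => t _; rewrite mulr1.
have -> : \int[mu]_(t in `[x, y]) (1 ^+ 2) = y - x.
  have dG t : is_derive t (1 : R) (@idfun R) 1 by exact: is_derive_id.
  rewrite -(Rintegral_is_derive xy c1 dG).
  by apply: eq_Rintegral => t _; rewrite expr1n.
rewrite mulrC; apply.
- exact: measurable_funS mk.
- exact: measurable_cst.
- exact: integrableS ik2.
- by apply: continuous_integrable_segment => t; exact: cvg_cst.
Qed.

(** The mean distance to an endpoint c of [x, y] is half the length; the
    statement covers both endpoints so as to serve both halves of a segment. *)
Lemma Rintegral_sqr_dist_le (x y c K : R) (F : R -> R) : x <= y -> continuous F ->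
  (forall t, x <= t -> t <= y -> (F t - F c) ^+ 2 <= `|t - c| * K) ->
  c = x \/ c = y ->
  \int[mu]_(t in `[x, y]) (F t - F c) ^+ 2 <= (y - x) ^+ 2 / 2 * K.
Proof.
move=> xy cF FK cxy.
(* e is the sign of t - c, constant on [x, y] because c is an endpoint *)
have [e [ecE ecE2]] : exists e : R, (forall t, x <= t -> t <= y -> `|t - c| = e * (t - c)) /\
    (e * (y - c) ^+ 2 - e * (x - c) ^+ 2 = (y - x) ^+ 2).
  case: cxy => ->; [exists 1|exists (-1)]; split; try by ring.
    by move=> t xt _; rewrite ger0_norm ?subr_ge0// mul1r.
  by move=> t _ ty; rewrite ler0_norm ?subr_le0// mulN1r.
have cF2 : continuous (fun t => (F t - F c) ^+ 2).
  move=> t; apply: (@continuous_comp _ _ _ (fun t => F t - F c) (fun z => z ^+ 2)).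
    by apply: continuousB; [exact: cF|exact: cst_continuous].
  exact: exprn_continuous.
have cK : continuous (fun t : R => K * (e * (t - c))).
  by move=> t; apply: cvgMr; apply: cvgMr; apply: cvgB; [exact: cvg_id|exact: cvg_cst].
apply: (@le_trans _ _ (\int[mu]_(t in `[x, y]) (K * (e * (t - c))))).
  apply: le_Rintegral => //; try exact: continuous_integrable_segment.
  move=> t; rewrite /= in_itv/= => /andP[xt ty].
  by rewrite -ecE// mulrC FK.
have dG t : is_derive t (1 : R) (fun t : R => K * (e * ((t - c) ^+ 2 / 2)))
    (K * (e * (t - c))).
  by apply: is_derive_eq; rewrite /GRing.scale/=; field.
rewrite (Rintegral_is_derive xy cK dG) -ecE2.
by rewrite le_eqVlt; apply/predU1P; left; field.
Qed.

(** On each half the distance to the midpoint integrates to (b - a)^2 / 8, and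
    only the part of int k^2 over that half is used. *)
Lemma poincare_midpoint (a b : R) (F k : R -> R) : a < b -> continuous F ->
  mu.-integrable `[a, b] (EFin \o (fun t => k t ^+ 2)) ->
  (forall x y, a <= x -> x <= y -> y <= b ->
    (F y - F x) ^+ 2 <= (y - x) * \int[mu]_(t in `[x, y]) k t ^+ 2) ->
  \int[mu]_(t in `[a, b]) (F t - F ((a + b) / 2)) ^+ 2 <=
  (b - a) ^+ 2 / 8 * \int[mu]_(t in `[a, b]) k t ^+ 2.
Proof.
move=> ab cF ik FK; set m := (a + b) / 2.
have [am mb] : a <= m /\ m <= b by rewrite /m; split; lra.
have sub x y : a <= x -> y <= b -> `[x, y]%classic `<=` (`[a, b]%classic : set R).
  move=> ax yb t; rewrite /= !in_itv/= => /andP[xt ty].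
  by rewrite (le_trans ax)//= (le_trans ty).
have ikS x y : a <= x -> y <= b -> mu.-integrable `[x, y] (EFin \o (fun t => k t ^+ 2)).
  by move=> ax yb; apply: integrableS ik => //; exact: sub.
have mono x y s t : a <= x -> x <= s -> s <= t -> t <= y -> y <= b ->
    \int[mu]_(t in `[s, t]) k t ^+ 2 <= \int[mu]_(t in `[x, y]) k t ^+ 2.
  move=> ax xs st ty yb; have ge0 u v : 0 <= \int[mu]_(t in `[u, v]) k t ^+ 2.
    by apply: Rintegral_ge0 => z _; exact: sqr_ge0.
  rewrite (@Rintegral_segment_split x s y) ?(le_trans st)//; last exact: ikS.
  rewrite (@Rintegral_segment_split s t y)//; last exact: ikS (le_trans ax xs) yb.
  by rewrite addrCA lerDl addr_ge0.
have cF2 : continuous (fun t => (F t - F m) ^+ 2).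
  move=> t; apply: (@continuous_comp _ _ _ (fun t => F t - F m) (fun z => z ^+ 2)).
    by apply: continuousB; [exact: cF|exact: cst_continuous].
  exact: exprn_continuous.
rewrite (Rintegral_segment_split am mb); last exact: continuous_integrable_segment.
rewrite (Rintegral_segment_split am mb ik).
have left := @Rintegral_sqr_dist_le a m m (\int[mu]_(t in `[a, m]) k t ^+ 2) F am cF.
have right := @Rintegral_sqr_dist_le m b m (\int[mu]_(t in `[m, b]) k t ^+ 2) F mb cF.
have := lerD (left _ (or_intror erefl)) (right _ (or_introl erefl)).
have -> : m - a = (b - a) / 2 by rewrite /m; field.
have -> : b - m = (b - a) / 2 by rewrite /m; field.
have -> : (b - a) ^+ 2 / 8 = ((b - a) / 2) ^+ 2 / 2 by field.
rewrite mulrDr; apply.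
- move=> t at_ tm; rewrite -sqrrN opprB distrC ger0_norm ?subr_ge0//.
  apply: (le_trans (FK _ _ at_ tm mb)); apply: ler_wpM2l; first by rewrite subr_ge0.
  exact: mono.
- move=> t mt tb; rewrite ger0_norm ?subr_ge0//.
  apply: (le_trans (FK _ _ am mt tb)); apply: ler_wpM2l; first by rewrite subr_ge0.
  exact: mono.
Qed.

End Poincare.

(** * Square-integrable functions on a segment *)

Section L2Segment.
Context {R : realType} (a b : R).
Local Notation mu := (@lebesgue_measure R).

Let sqr_patch (h : R -> R) :
  (fun x => (h \_ `[a, b]%classic) x ^+ 2) = (fun x => h x ^+ 2) \_ `[a, b]%classic.
Proof. by apply/funext => x; rewrite /patch; case: ifPn => // _; rewrite expr0n. Qed.

Lemma in_L2_sqr_integrable (h : R -> R) : in_L2 a b h ->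
  measurable_fun (`[a, b] : set R) h /\
  mu.-integrable `[a, b] (EFin \o (fun x => h x ^+ 2)).
Proof.
move=> hL2; split.
  have := sub_Lfun_mfun hL2; rewrite inE /= => mh.
  by apply/(measurable_restrictT _ _).2.
have := Lfun2_integrable_sqr hL2; rewrite sqr_patch.
have mab : measurable (`[a, b]%classic : set (measurableTypeR R)) by exact: measurable_itv.
by rewrite -restrict_EFin => ih; apply/(integrable_mkcond _ mab).
Qed.

Lemma L2norm_sqrt (h : R -> R) :
  mu.-integrable `[a, b] (EFin \o (fun x => h x ^+ 2)) ->
  L2norm a b h = (Num.sqrt (\int[mu]_(x in `[a, b]) h x ^+ 2))%:E.
Proof.
move=> ih; rewrite /L2norm unlock.
have -> : (\int[mu]_x (`|(EFin \o (h \_ `[a, b]%classic)) x| `^ 2) =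
    \int[mu]_(x in `[a, b]) (h x ^+ 2)%:E)%E.
  transitivity (\int[mu]_x (EFin \o (fun x : R => ((h \_ `[a, b]%classic) x ^+ 2)%R)) x)%E.
    apply: eq_integral => x _ /=.
    by rewrite powR_mulrn// real_normK// num_real.
  by rewrite sqr_patch -restrict_EFin [RHS]integral_mkcond.
rewrite -[X in (X `^ _)%E]fineK; last exact: integrable_fin_num.
rewrite poweR_EFin powR12_sqrt//.
by apply: Rintegral_ge0 => x _; exact: sqr_ge0.
Qed.

End L2Segment.

(** * The Poincare bound for one function *)

Section SingleFunction.
Context {R : realType} (a b : R) (f : R -> R).
Hypotheses (a0 : 0 < a) (ab : a < b) (acf : abs_continuous a b f).
Local Notation mu := (@lebesgue_measure R).

Lemma abs_continuous_clamp_continuous : continuous (f \o clamp a b).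
Proof. exact/ac_line_continuous/(ac_line_clamp (ltW ab)). Qed.

Lemma abs_continuous_bounded :
  exists2 M, 0 < M & forall x, a <= x <= b -> `|f x| <= M.
Proof.
have cn : continuous (fun x => `|(f \o clamp a b) x|).
  move=> x; apply: (@continuous_comp _ _ _ (f \o clamp a b) Num.norm).
    exact: abs_continuous_clamp_continuous.
  exact: norm_continuous.
have [c cab cmax] := EVT_max (ltW ab) (continuous_subspaceT cn).
exists (`|(f \o clamp a b) c| + 1); first by rewrite ltr_wpDl.
move=> x xab; have := cmax x; rewrite in_itv/= clamp_id// => /(_ xab) /le_trans.
by apply; rewrite lerDl.
Qed.

(** A quotient of absolutely continuous functions whose denominator stays away
    from 0: the increment of f / x is at most |f y - f x| / a plus
    M / a^2 times the length, where M bounds f. *)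
Lemma abs_continuous_div_id : abs_continuous a b (fun x => f x / x).
Proof.
have [M M0 fM] := abs_continuous_bounded.
move=> e e0; have ea0 : 0 < e * a / 2 by rewrite divr_gt0// mulr_gt0.
have [d d0 fd] := acf ea0.
(* each of the two terms of the bound on the increments gets e / 2 *)
exists (Num.min d (e * a ^+ 2 / (2 * M))).
  by rewrite lt_min d0 divr_gt0// ?mulr_gt0// exprn_gt0.
move=> n x y xy dis; rewrite lt_min => /andP[sd sM].
have step i : `|f (y i) / y i - f (x i) / x i| <=
    a^-1 * `|f (y i) - f (x i)| + M / a ^+ 2 * (y i - x i).
  have [ax [xlty yb]] := xy i.
  have [x0 y0] : 0 < x i /\ 0 < y i.
    by split; [exact: lt_le_trans ax|exact: lt_trans (lt_le_trans a0 ax) xlty].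
  have -> : f (y i) / y i - f (x i) / x i = (y i)^-1 * (f (y i) - f (x i)) -
      f (x i) * ((y i - x i) / (x i * y i)).
    by field; rewrite !gt_eqF.
  apply: (le_trans (ler_normB _ _)); apply: lerD; rewrite normrM.
    apply: ler_wpM2r => //; rewrite gtr0_norm ?invr_gt0// lef_pV2 ?posrE//.
    by rewrite (le_trans ax)// ltW.
  rewrite mulrAC -mulrA; apply: ler_pM => //.
    by apply: fM; rewrite ax (le_trans (ltW xlty)).
  rewrite ger0_norm; last by rewrite divr_ge0 ?subr_ge0 ?ltW// mulr_gt0.
  apply: ler_wpM2l; first by rewrite subr_ge0 ltW.
  rewrite lef_pV2 ?posrE ?mulr_gt0 ?exprn_gt0// expr2.
  by apply: ler_pM => //; rewrite ?ltW// (le_lt_trans ax).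
apply: (@le_lt_trans _ _ (\sum_(i < n)
    (a^-1 * `|f (y i) - f (x i)| + M / a ^+ 2 * (y i - x i)))).
  exact: ler_sum.
rewrite big_split/= -!mulr_sumr.
have := fd n x y xy dis sd; set S := \sum_(i < n) `|_| => Se.
set T := \sum_(i < n) (_ - _) in sd sM *.
have -> : e = a^-1 * (e * a / 2) + M / a ^+ 2 * (e * a ^+ 2 / (2 * M)).
  by field; rewrite !gt_eqF.
by apply: ltrD; rewrite ltr_pM2l// ?invr_gt0// divr_gt0// exprn_gt0.
Qed.

Hypothesis f'L2 : in_L2 a b (derive1 f).
Local Notation h := (fun t => t * derive1 f t - f t).

Let mab : measurable (`[a, b]%classic : set (measurableTypeR R)).
Proof. exact: measurable_itv. Qed.

Lemma measurable_abs_continuous : measurable_fun (`[a, b] : set R) f.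
Proof.
apply: (eq_measurable_fun (f \o clamp a b)).
  by move=> x; rewrite inE/= in_itv/= => xab; rewrite clamp_id.
apply: measurable_funTS; apply: continuous_measurable_fun.
exact: abs_continuous_clamp_continuous.
Qed.

Lemma measurable_pompeiu_deriv : measurable_fun (`[a, b] : set R) h.
Proof.
have [mf' _] := in_L2_sqr_integrable f'L2.
apply: measurable_funB; last exact: measurable_abs_continuous.
exact: measurable_funM.
Qed.

(** (t f' - f)^2 <= 2 b^2 f'^2 + 2 M^2, where M bounds f on [a, b]. *)
Lemma pompeiu_deriv_sqr_integrable :
  mu.-integrable `[a, b] (EFin \o (fun t => h t ^+ 2)).
Proof.
have [mf' if'2] := in_L2_sqr_integrable f'L2.
have [M M0 fM] := abs_continuous_bounded.
have iM : mu.-integrable `[a, b] (EFin \o (fun=> 2 * M ^+ 2)).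
  by apply: continuous_integrable_segment => t; exact: cvg_cst.
have hle (t : R) : a <= t <= b ->
    h t ^+ 2 <= 2 * b ^+ 2 * derive1 f t ^+ 2 + 2 * M ^+ 2.
  move=> tab; have /andP[at_ tb] := tab.
  have [t0 b0] : 0 <= t /\ 0 <= b.
    by split; [exact: ltW (lt_le_trans a0 at_)|exact: ltW (lt_trans a0 ab)].
  have t2 : t ^+ 2 <= b ^+ 2 by rewrite ler_pXn2r ?nnegrE.
  have f2 : f t ^+ 2 <= M ^+ 2.
    by rewrite -(real_normK (num_real (f t))) ler_pXn2r ?nnegrE ?fM// ltW.
  have := ler_wpM2r (sqr_ge0 (derive1 f t)) t2.
  have := sqr_ge0 (t * derive1 f t + f t).
  by move: (derive1 f t) => f't; nra.
have := integrableD mab (integrableZl mab (2 * b ^+ 2) if'2) iM.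
apply: le_integrable => //.
  by apply/measurable_EFinP; apply: measurable_funX; exact: measurable_pompeiu_deriv.
move=> t; rewrite /= in_itv/= => tab; rewrite lee_fin.
rewrite ger0_norm ?sqr_ge0// ger0_norm ?hle//.
exact: le_trans (sqr_ge0 _) (hle t tab).
Qed.

(** Differentiability is assumed of f / x, to which the fundamental theorem is
    applied; that of f follows, since f = (f / x) x near x. *)
Lemma derive_div_id x : x \in `]a, b[ -> derivable (fun x => f x / x) x 1 ->
  derive1 (fun x => f x / x) x = h x / x ^+ 2.
Proof.
move=> xab dF.
have x0 : 0 < x by move: xab; rewrite in_itv/= => /andP[/(lt_trans a0)].
have near_eq : {near x, (fun y => f y / y * y) =1 f}.
  have := near_in_itvoo xab; apply: filterS => y.
  rewrite in_itv/= => /andP[/(lt_trans a0) y0 _].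
  by rewrite divfK// gt_eqF.
have df : derivable f x 1.
  by apply: near_eq_derivable near_eq _; apply: derivableM => //; exact: derivable_id.
have Df : is_derive x 1 f (derive1 f x) by rewrite derive1E; exact: derivableP.
rewrite derive1E.
have xn0 : x != 0 by rewrite gt_eqF.
have Dx := is_deriveV xn0 (is_derive_id x 1).
have [_ H] := is_deriveM Df Dx; apply: (etrans H).
by rewrite /GRing.scale/=; field.
Qed.

(** Poincare inequality for F = f / x with c = F(m); the factor b^2 comes from
    f - c x = x (F - c) and the factor a^-4 from F' = (x f' - f) / x^2. *)
Lemma pompeiu_single_bound : exists c : R,
  \int[mu]_(x in `[a, b]) ((f \o clamp a b) x - c * x) ^+ 2 <=
  b ^+ 2 * (b - a) ^+ 2 / (8 * a ^+ 4) * \int[mu]_(x in `[a, b]) h x ^+ 2.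
Proof.
have [b0 a2 a4] : [/\ 0 < b, 0 < a ^+ 2 & 0 < a ^+ 4].
  by rewrite (lt_trans a0 ab) !exprn_gt0.
have mh := measurable_pompeiu_deriv; have ih2 := pompeiu_deriv_sqr_integrable.
pose F x := f x / x; pose k x := h x / x ^+ 2.
pose Fc := F \o clamp a b.
have acF : abs_continuous a b F by exact: abs_continuous_div_id.
have cFc : continuous Fc by exact/ac_line_continuous/(ac_line_clamp (ltW ab)).
have mk : measurable_fun (`[a, b] : set R) k.
  apply: (eq_measurable_fun (fun x => h x * (clamp a b x ^+ 2)^-1)).
    by move=> x; rewrite inE/= in_itv/= => xab; rewrite clamp_id.
  apply: measurable_funM => //; apply: measurable_funTS.
  apply: continuous_measurable_fun => x; apply: cvgV.
    by rewrite expf_neq0// gt_eqF// (lt_le_trans a0)// clamp_ge.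
  apply: (@continuous_comp _ _ _ (clamp a b) (fun z => z ^+ 2)).
    exact: (clamp_continuous (ltW ab)).
  exact: exprn_continuous.
have k2le (t : R) : a <= t <= b -> k t ^+ 2 <= (a ^+ 4)^-1 * h t ^+ 2.
  move=> /andP[at_ tb]; have t0 : 0 < t by exact: lt_le_trans at_.
  rewrite /k expr_div_n mulrC ler_wpM2r ?sqr_ge0// -exprM.
  rewrite lef_pV2 ?posrE; [|exact: exprn_gt0|exact: exprn_gt0].
  by rewrite ler_pXn2r ?nnegrE//; exact: ltW.
have ik2' := integrableZl mab (a ^+ 4)^-1 ih2.
have ik2 : mu.-integrable `[a, b] (EFin \o (fun t => k t ^+ 2)).
  apply: le_integrable ik2' => //; first exact/measurable_EFinP/measurable_funX.
  move=> t; rewrite /= in_itv/= => tab; rewrite lee_fin.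
  by rewrite ger0_norm ?sqr_ge0// (le_trans (k2le t tab)) ?ler_norm.
have Fk x : x \in `]a, b[ -> derivable F x 1 -> derive1 F x = k x.
  exact: derive_div_id.
have inc := sqr_increment_le ab acF mk Fk ik2.
have incc x y : a <= x -> x <= y -> y <= b ->
    (Fc y - Fc x) ^+ 2 <= (y - x) * \int[mu]_(t in `[x, y]) k t ^+ 2.
  move=> ax xy yb; rewrite /Fc /= !clamp_id ?inc ?ax ?(le_trans xy)//.
  by rewrite (le_trans ax).
have := poincare_midpoint ab cFc ik2 incc.
set c := Fc _ => poin; exists c.
have cu : continuous (fun x => (f \o clamp a b) x - c * x).
  move=> x; apply: cvgB; first exact: abs_continuous_clamp_continuous.
  by apply: cvgMr; exact: cvg_id.
have sq (u : R -> R) : continuous u -> continuous (fun x => u x ^+ 2).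
  move=> uc x; apply: (@continuous_comp _ _ _ u (fun z => z ^+ 2)); first exact: uc.
  exact: exprn_continuous.
have cFm : continuous (fun x => (Fc x - c) ^+ 2).
  by apply: (sq (fun x => Fc x - c)) => x; apply: cvgB; [exact: cFc|exact: cvg_cst].
apply: (@le_trans _ _ (\int[mu]_(x in `[a, b]) (b ^+ 2 * (Fc x - c) ^+ 2))).
  apply: le_Rintegral => //.
  - exact: continuous_integrable_segment (sq _ cu).
  - by apply: continuous_integrable_segment => x; apply: cvgMr; exact: cFm.
  - move=> x; rewrite /= in_itv/= => xab; have /andP[ax xb] := xab.
    have x0 : 0 < x by exact: lt_le_trans ax.
    rewrite /Fc /F /= clamp_id//.
    have -> : f x - c * x = x * (f x / x - c) by field; rewrite gt_eqF.
    by rewrite exprMn ler_wpM2r ?sqr_ge0// ler_pXn2r ?nnegrE//; exact: ltW.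
rewrite RintegralZl//; last exact: continuous_integrable_segment.
have k2 : \int[mu]_(t in `[a, b]) k t ^+ 2 <=
    (a ^+ 4)^-1 * \int[mu]_(t in `[a, b]) h t ^+ 2.
  rewrite -RintegralZl//; exact: le_Rintegral.
have -> : b ^+ 2 * (b - a) ^+ 2 / (8 * a ^+ 4) * \int[mu]_(x in `[a, b]) h x ^+ 2 =
    b ^+ 2 * ((b - a) ^+ 2 / 8 * ((a ^+ 4)^-1 * \int[mu]_(t in `[a, b]) h t ^+ 2)).
  by field; rewrite gt_eqF.
apply: ler_wpM2l; first exact: sqr_ge0.
apply: (le_trans poin); apply: ler_wpM2l => //.
by rewrite divr_ge0 ?sqr_ge0.
Qed.

End SingleFunction.

(** * The inequality *)

(** After cancellation the two sides are a^2 (b - a) / 8 and 2 W / pi^2. *)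
Lemma pompeiu_constant_le (R : realType) (a b : R) : 0 < a -> a < b ->
  (b ^+ 3 - a ^+ 3) / 3 * (b ^+ 2 * (b - a) ^+ 2 / (8 * a ^+ 4)) <=
  2 / (9 * pi ^+ 2) * (b ^+ 2 / a ^+ 6) * (b ^+ 3 - a ^+ 3) ^+ 2 * (b - a).
Proof.
move=> a0 ab; set W := (b ^+ 3 - a ^+ 3) / 3.
have b0 : 0 < b by exact: lt_trans ab.
have l0 : 0 < b - a by rewrite subr_gt0.
have Wge : a ^+ 2 * (b - a) <= W.
  rewrite -subr_ge0 /W.
  have -> : (b ^+ 3 - a ^+ 3) / 3 - a ^+ 2 * (b - a) =
      (b - a) ^+ 2 * (b + 2 * a) / 3 by field.
  by rewrite divr_ge0// mulr_ge0 ?sqr_ge0// addr_ge0 ?mulr_ge0 ?ltW.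
have W0 : 0 < W by apply: lt_le_trans Wge; rewrite mulr_gt0// exprn_gt0.
have pi4 : (pi : R) ^+ 2 <= 16.
  have -> : 16 = 4 ^+ 2 :> R by ring.
  rewrite ler_pXn2r ?nnegrE ?pi_ge0//; have := @pihalf_lt2 R; lra.
have pi2 : 0 < (pi : R) ^+ 2 by rewrite exprn_gt0// pi_gt0.
have [pin0 an0] : (pi : R) != 0 /\ a != 0 by rewrite !gt_eqF ?pi_gt0.
move: (pi : R) pi4 pi2 pin0 => p p4 p2 pn0.
have -> : W * (b ^+ 2 * (b - a) ^+ 2 / (8 * a ^+ 4)) =
    (W * (b ^+ 2 * (b - a) / a ^+ 6)) * ((a ^+ 2 * (b - a)) * 8^-1).
  by field.
have -> : 2 / (9 * p ^+ 2) * (b ^+ 2 / a ^+ 6) * (b ^+ 3 - a ^+ 3) ^+ 2 * (b - a) =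
    (W * (b ^+ 2 * (b - a) / a ^+ 6)) * (W * (2 / p ^+ 2)).
  by rewrite /W; field; rewrite pn0 an0.
apply: ler_wpM2l.
  by apply: ltW; rewrite mulr_gt0// divr_gt0 ?exprn_gt0// mulr_gt0 ?exprn_gt0.
apply: ler_pM => //; first by apply: ltW; rewrite mulr_gt0 ?exprn_gt0.
rewrite ler_pdivlMr//; lra.
Qed.

Theorem theorem8 (R : realType) (a b : R) (f g : R -> R)
    (ha : 0 < a) (hab : a < b)
    (hf : abs_continuous a b f) (hg : abs_continuous a b g)
    (hf' : in_L2 a b (derive1 f)) (hg' : in_L2 a b (derive1 g)) :
  (`|pompeiu_chebyshev a b f g|%:E <=
    (2 / (9 * pi ^+ 2) * (b ^+ 2 / a ^+ 6) *
       (b ^+ 3 - a ^+ 3) ^+ 2 * (b - a))%:E *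
    L2norm a b (fun t => (t * derive1 f t - f t)%R) *
    L2norm a b (fun t => (t * derive1 g t - g t)%R))%E.
Proof.
rewrite !L2norm_sqrt; [|exact: pompeiu_deriv_sqr_integrable..].
rewrite -!EFinM lee_fin.
set Hf := \int[lebesgue_measure]_(x in _) (_ * derive1 f _ - _) ^+ 2.
set Hg := \int[lebesgue_measure]_(x in _) (_ * derive1 g _ - _) ^+ 2.
have Hf0 : 0 <= Hf by apply: Rintegral_ge0 => x _; exact: sqr_ge0.
have Hg0 : 0 <= Hg by apply: Rintegral_ge0 => x _; exact: sqr_ge0.
have cf := abs_continuous_clamp_continuous hab hf.
have cg := abs_continuous_clamp_continuous hab hg.
have -> : pompeiu_chebyshev a b f g =
    pompeiu_chebyshev a b (f \o clamp a b) (g \o clamp a b).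
  have E (u v : R -> R) : {in `[a, b], u =1 v} ->
      \int[@lebesgue_measure R]_(x in `[a, b]) u x =
      \int[@lebesgue_measure R]_(x in `[a, b]) v x.
    by move=> uv; apply: eq_Rintegral => x; rewrite inE => /uv.
  rewrite /pompeiu_chebyshev; congr (_ * _ - _ * _); apply: E => x;
    by rewrite in_itv/= => xab; rewrite /= clamp_id.
have [c fc] := pompeiu_single_bound ha hab hf hf'.
have [d gd] := pompeiu_single_bound ha hab hg hg'.
rewrite -(pompeiu_chebyshev_shift (ltW hab) c d cf cg).
have cs (u : R -> R) e : continuous u -> continuous (fun x => u x - e * x).
  by move=> cu x; apply: cvgB; [exact: cu|apply: cvgMr; exact: cvg_id].
have := pompeiu_chebyshev_le (ltW hab) hab (ltW ha) (cs _ c cf) (cs _ d cg).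
set P := pompeiu_chebyshev _ _ _ _.
set W := (b ^+ 3 - a ^+ 3) / 3 => PW.
set C0 := b ^+ 2 * (b - a) ^+ 2 / (8 * a ^+ 4) in fc gd.
have hb := lt_trans ha hab.
have W0 : 0 <= W.
  by apply: ltW; rewrite divr_gt0// subr_gt0 ltr_pXn2r ?nnegrE//; exact: ltW.
have C00 : 0 <= C0.
  apply: divr_ge0; first by rewrite mulr_ge0 ?sqr_ge0.
  by apply: ltW; rewrite mulr_gt0// exprn_gt0.
apply: (@le_trans _ _ (W * C0 * Num.sqrt Hf * Num.sqrt Hg)); last first.
  do 2 (apply: ler_wpM2r; first exact: sqrtr_ge0).
  exact: pompeiu_constant_le.
have RHS0 : 0 <= W * C0 * Num.sqrt Hf * Num.sqrt Hg.
  by do !apply: mulr_ge0 => //; exact: sqrtr_ge0.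
rewrite -(ler_pXn2r (n := 2)) ?nnegrE// real_normK ?num_real//.
apply: (le_trans PW).
have -> : (W * C0 * Num.sqrt Hf * Num.sqrt Hg) ^+ 2 =
    W ^+ 2 * ((C0 * Hf) * (C0 * Hg)).
  by rewrite [LHS]exprMn [in LHS]exprMn !sqr_sqrtr//; ring.
apply: ler_wpM2l; first exact: sqr_ge0.
by apply: ler_pM => //; apply: Rintegral_ge0 => x _; exact: sqr_ge0.
Qed.
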